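(* Let $T\in B(\mathcal H)$ with $T\in[(1,1)DN]$, i.e. $T$ is Drazin invertible with Drazin inverse $T_d$ satisfying $[T_d,T^*]=0$. If $X\in B(\mathcal H)$ satisfies $[T,X]=0$, then $[T_d^*,X]=0$.
   Context: $\mathcal H$ is a complex infinite dimensional Hilbert space and $B(\mathcal H)$ is the algebra of bounded linear operators on $\mathcal H$; $[X,Y]=XY-YX$. An operator $T\in B(\mathcal H)$ is Drazin invertible if there is $T_d\in B(\mathcal H)$ (the Drazin inverse) with $[T_d,T]=0$, $T_d^2T=T_d$ and $T^{p+1}T_d=T^p$ for some integer $p\ge1$ (if $T$ is invertible, $T_d=T^{-1}$). $T_d^*$ denotes the adjoint of $T_d$. *)

(* Defs.v *)
From HB Require Import structures.
From mathcomp Require Import all_boot all_order all_algebra ring lra.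
From mathcomp Require Import complex.
From mathcomp Require Import boolp classical_sets functions reals topology.
From mathcomp Require Import normedtype sequences.

Set Implicit Arguments.
Unset Strict Implicit.
Unset Printing Implicit Defensive.

Import Order.TTheory GRing.Theory Num.Theory.
Import numFieldNormedType.Exports.

Local Open Scope ring_scope.
Local Open Scope complex_scope.

(* The inner product is linear in its first argument and conjugate-linear in
   the second; it induces the norm for which H is complete. *)
HB.mixin Record CompleteNormedModule_isHilbert (R : realType) H
    & CompleteNormedModule R[i] H := {
  inner : {dot H for @Num.conj R[i]};
  sqr_normE : forall x : H, `|x| ^+ 2 = inner x x
}.

#[short(type="hilbertType")]
HB.structure Definition Hilbert (R : realType) :=
  {H of CompleteNormedModule R[i] H & CompleteNormedModule_isHilbert R H}.

Notation "''[' x , y ]" := (inner x y) : ring_scope.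

Definition infinite_dimensional (K : nzRingType) (V : lmodType K) :=
  ~ exists (n : nat) (e : 'I_n -> V),
      forall x, exists c : 'I_n -> K, x = \sum_(i < n) c i *: e i.

Section BoundedOperators.
Variables (R : realType) (H : hilbertType R).

Definition bounded_linear : {pred H -> H} :=
  [pred f | `[< linear f /\ exists M, forall x, `|f x| <= M * `|x| >]].

Record boundedOp := BoundedOp {
  bop_fun :> H -> H;
  bop_subproof : bop_fun \in bounded_linear
}.

HB.instance Definition _ := [isSub for bop_fun].
HB.instance Definition _ := [Choice of boundedOp by <:].

Lemma bopP (S T : boundedOp) : S = T <-> forall x, S x = T x.
Proof. by split=> [->//|ST]; apply: val_inj; apply/funext. Qed.

Lemma bop_is_linear (T : boundedOp) : linear T.
Proof. by have /asboolP[] := bop_subproof T. Qed.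

HB.instance Definition _ (T : boundedOp) :=
  GRing.isLinear.Build R[i] H H *:%R T (bop_is_linear T).

Lemma bop_bounded (T : boundedOp) :
  exists2 M : R[i], 0 <= M & forall x, `|T x| <= M * `|x|.
Proof.
have /asboolP[_ [M Mf]] := bop_subproof T; exists `|M| => // x.
have [->|x0] := eqVneq x 0; first by rewrite linear0 normr0 mulr0.
have M0 : 0 <= M.
  by rewrite -(@pmulr_lge0 _ `|x|) ?normr_gt0//; exact: le_trans (Mf x).
by rewrite ger0_norm.
Qed.

Lemma bounded_linear_zmod : zmod_closed bounded_linear.
Proof.
split=> [|f g /asboolP[lf [M Mf]] /asboolP[lg [N Ng]]]; apply/asboolP; split.
- by move=> a x y; rewrite /= scaler0 addr0.
- by exists 0 => x; rewrite normr0 mul0r.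
- by move=> a x y; rewrite !fctE lf lg scalerBr opprD addrACA.
- exists (M + N) => x; rewrite mulrDl.
  by rewrite (le_trans (ler_normB _ _))// lerD.
Qed.

HB.instance Definition _ :=
  GRing.isZmodClosed.Build (H -> H) bounded_linear bounded_linear_zmod.
HB.instance Definition _ := [SubChoice_isSubZmodule of boundedOp by <:].

Lemma bounded_linear_id : idfun \in bounded_linear.
Proof.
by apply/asboolP; split=> //; exists 1 => x; rewrite mul1r.
Qed.

Lemma bounded_linear_comp (S T : boundedOp) : (S \o T) \in bounded_linear.
Proof.
apply/asboolP; split=> [a x y|]; first by rewrite /= !linearP.
have [M M0 SM] := bop_bounded S; have [N N0 TN] := bop_bounded T.
exists (M * N) => x; rewrite (le_trans (SM _))// -mulrA ler_wpM2l//.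
Qed.

Definition bop1 := BoundedOp bounded_linear_id.
Definition bop_mul (S T : boundedOp) := BoundedOp (bounded_linear_comp S T).

Fact bop_mulA : associative bop_mul. Proof. by move=> S T U; apply/bopP. Qed.
Fact bop_mul1 : left_id bop1 bop_mul. Proof. by move=> S; apply/bopP. Qed.
Fact bop_mulr1 : right_id bop1 bop_mul. Proof. by move=> S; apply/bopP. Qed.
Fact bop_mulDl : left_distributive bop_mul +%R.
Proof. by move=> S T U; apply/bopP. Qed.
Fact bop_mulDr : right_distributive bop_mul +%R.
Proof. by move=> S T U; apply/bopP => x; exact: raddfD. Qed.

HB.instance Definition _ := GRing.Zmodule_isPzRing.Build boundedOp
  bop_mulA bop_mul1 bop_mulr1 bop_mulDl bop_mulDr.

End BoundedOperators.

Section Adjoint.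
Variables (R : realType) (H : hilbertType R).
Implicit Types (x y z : H) (T : boundedOp H).

Let rip x y : R := complex.Re '[x, y].

Let ripC x y : rip x y = rip y x.
Proof. by rewrite /rip hermC expr0 mul1r /=; case: (inner y x) => a b; exact: erefl. Qed.

Let ripDl x y z : rip (x + y) z = rip x z + rip y z.
Proof. by rewrite /rip linearDl raddfD. Qed.

Let ripZl (t : R) x y : rip (t%:C *: x) y = t * rip x y.
Proof.
by rewrite /rip linearZl_LR /=; case: ('[x, y]) => a b /=; rewrite mul0r subr0.
Qed.

Let ripDr x y z : rip x (y + z) = rip x y + rip x z.
Proof. by rewrite !(ripC x) ripDl. Qed.

Let ripZr (t : R) x y : rip x (t%:C *: y) = t * rip x y.
Proof. by rewrite !(ripC x) ripZl. Qed.

Let ripNl x y : rip (- x) y = - rip x y.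
Proof. by rewrite /rip linearNl raddfN. Qed.

Let ripNr x y : rip x (- y) = - rip x y.
Proof. by rewrite !(ripC x) ripNl. Qed.

Let ripE x : '[x, x] = (rip x x)%:C.
Proof.
have := dnorm_ge0 (@inner R H) x; rewrite /rip.
by case: ('[x, x]) => a b; rewrite lecE /= => /andP[/eqP -> _].
Qed.

Let posC (c : R[i]) : 0 < c -> exists2 r : R, 0 < r & c = r%:C.
Proof.
by case: c => r i; rewrite ltcE /= => /andP[/eqP -> r0]; exists r.
Qed.

Let normE x : `|x| ^+ 2 = (rip x x)%:C.
Proof. by rewrite sqr_normE ripE. Qed.

Let rip_ge0 x : 0 <= rip x x.
Proof. by rewrite -lecR -ripE dnorm_ge0. Qed.

Let amgm (s : R) x y : 0 < s -> 2 * rip x y <= s * rip x x + rip y y / s.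
Proof.
move=> s0; rewrite -(ler_pM2l s0) mulrDr [s * (_ / s)]mulrC divfK ?gt_eqF//.
have := rip_ge0 (s%:C *: x - y).
rewrite ripDl !ripDr !ripNl !ripNr !ripZl !ripZr (ripC y x).
by lra.
Qed.

Let opK T : exists2 K : R, 0 < K & forall x, rip (T x) (T x) <= K * rip x x.
Proof.
have [[m im] M0 TM] := bop_bounded T.
move: M0; rewrite lecE /= => /andP[/eqP im0 m0]; subst im.
exists (m ^+ 2 + 1) => [|x]; first by rewrite ltr_wpDl// sqr_ge0.
apply: (@le_trans _ _ (m ^+ 2 * rip x x)); last first.
  by rewrite ler_wpM2r// lerDl.
have : `|T x| ^+ 2 <= (m%:C * `|x|) ^+ 2.
  by rewrite lerXn2r ?nnegrE ?mulr_ge0 ?normr_ge0 ?lecR.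
by rewrite exprMn !normE -rmorphXn -rmorphM lecR.
Qed.

Let opD T x y : T (x + y) = T x + T y. Proof. exact: linearD. Qed.
Let opB T x y : T (x - y) = T x - T y. Proof. exact: linearB. Qed.
Let opZ T a x : T (a *: x) = a *: T x. Proof. exact: linearZ. Qed.

(* Riesz representation of x |-> '[T x, y]: the representing vector minimizes
   J x = |x|^2 - 2 Re '[T x, y]. *)
Lemma adjoint_point T y : exists z, forall x, '[T x, y] = '[x, z].
Proof.
have [K K0 TK] := opK T.
pose J x := rip x x - 2 * rip (T x) y.
pose E : set R := range J.
have J_lb x : - (K * rip y y) <= J x.
  have := amgm (T x) y (s := K^-1); rewrite invr_gt0 invrK => /(_ K0).
  have : K^-1 * rip (T x) (T x) <= rip x x.
    by rewrite mulrC ler_pdivrMr// mulrC.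
  by rewrite /J; lra.
have E0 : has_inf E.
  split; first by exists (J 0), 0.
  by exists (- (K * rip y y)) => _ [x _ <-].
have infJ x : inf E <= J x by apply: ge_inf; [exact: E0.2|exists x].
have /choice[a aP] : forall n : nat, exists x, J x < inf E + n.+1%:R^-1.
  move=> n; have n0 : 0 < n.+1%:R^-1 :> R by rewrite invr_gt0.
  have [_ [x _ <-] xE] := inf_adherent n0 E0.
  by exists x.
have parallelogram x z : rip (x - z) (x - z) <= 2 * (J x + J z - 2 * inf E).
  have := infJ ((2^-1)%:C *: (x + z)); rewrite /J !opZ !opD.
  rewrite !(ripDl, ripDr, ripNl, ripNr, ripZl, ripZr) (ripC z x).
  by lra.
have aa m n : (m <= n)%N -> rip (a n - a m) (a n - a m) <= 4 / m.+1%:R.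
  move=> mn; rewrite (le_trans (parallelogram _ _))//.
  have := aP n; have := aP m.
  have : n.+1%:R^-1 <= m.+1%:R^-1 :> R by rewrite lef_pV2 ?posrE// ler_nat.
  set u := n.+1%:R^-1; set v := m.+1%:R^-1; set ja := J _; set jb := J _.
  by lra.
have acvg : cvgn a.
  apply/cauchy_cvgP/cauchy_exP => _ /posC[e e0 ->].
  have [m me] : exists m : nat, 4 / m.+1%:R < e ^+ 2.
    exists (Num.truncn (4 / e ^+ 2)).
    rewrite ltr_pdivrMr// mulrC -ltr_pdivrMr ?exprn_gt0//.
    by rewrite truncnS_gt.
  exists (a m); exists m => // n /= mn.
  rewrite -ball_normE /= distrC -(ltr_pXn2r (n := 2)) ?nnegrE ?normr_ge0//.
    by rewrite normE -rmorphXn ltcR; exact: le_lt_trans (aa _ _ mn) me.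
  by rewrite lecE /= eqxx ltW.
pose z := limn a.
have infz : J z <= inf E.
  apply/ler_addgt0Pr => e0 e0_gt0.
  pose B := rip z z + 1 + K + rip y y + 1.
  have B0 : 0 < B.
    by rewrite ltr_wpDl// !addr_ge0// ltW.
  pose e := e0 / B.
  have eB : e * B = e0 by rewrite divfK ?gt_eqF.
  have e_gt0 : 0 < e by rewrite divr_gt0.
  have /cvgrPdist_lt /(_ e%:C) : (a @ \oo --> z)%classic by [].
  rewrite ltcR => /(_ e_gt0)[N _ aN].
  have [m Nm me] : exists2 m : nat, (N <= m)%N & m.+1%:R^-1 < e.
    exists (maxn N (Num.truncn e^-1)); first exact: leq_maxl.
    rewrite invf_plt ?posrE// (lt_le_trans (truncnS_gt _))//.
    by rewrite ler_nat ltnS leq_maxr.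
  have [d dE] : exists d, d = z - a m by exists (z - a m).
  have de : rip d d <= e ^+ 2.
    rewrite ltW// -ltcR -normE rmorphXn /= ltr_pXn2r ?nnegrE ?normr_ge0//.
      by rewrite dE; exact: aN.
    by rewrite lecR ltW.
  have am : a m = z - d by rewrite dE subKr.
  have := aP m; rewrite am /J opB.
  rewrite !(ripDl, ripDr, ripNl, ripNr) (ripC d z).
  have zd := amgm z d e_gt0.
  have Td := amgm y (- T d) e_gt0.
  rewrite ripNr ripNl ripNr opprK (ripC y (T d)) in Td.
  have de' : rip d d / e <= e by rewrite ler_pdivrMr// -expr2.
  have Tde : rip (T d) (T d) / e <= K * e.
    rewrite ler_pdivrMr// (le_trans (TK d))// -mulrA ler_pM2l//.
  have d0 := rip_ge0 d.
  rewrite -eB /B /J; set u := m.+1%:R^-1 in me *.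
  by lra.
have zopt v : rip v z = rip (T v) y.
  have key (t : R) : 0 <= t ^+ 2 * rip v v + 2 * t * (rip v z - rip (T v) y).
    have := le_trans infz (infJ (z + t%:C *: v)).
    rewrite /J opD opZ.
    rewrite !(ripDl, ripDr, ripZl, ripZr) (ripC z v) expr2.
    by lra.
  apply/eqP; rewrite -subr_eq0; set p := _ - _; rewrite -sqrf_eq0.
  rewrite eq_le sqr_ge0 andbT.
  have := key (- p / (rip v v + 1)).
  rewrite -/p; set q := rip v v + 1; have vq : rip v v = q - 1 by rewrite addrK.
  have q0 : 0 < q by rewrite ltr_wpDl.
  have -> : (- p / q) ^+ 2 * rip v v + 2 * (- p / q) * p
          = - (p ^+ 2 * (q + 1)) / q ^+ 2.
    by rewrite vq; field; rewrite gt_eqF.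
  rewrite pmulr_lge0 ?invr_gt0 ?exprn_gt0// oppr_ge0 pmulr_lle0//.
  by rewrite addr_gt0.
exists z => x; apply/eqP; rewrite eq_complex; apply/andP; split; apply/eqP.
  by rewrite -[LHS]zopt.
have := zopt ('i%C *: x); rewrite /rip opZ !linearZl_LR /=.
case: ('[x, z]) ('[T x, y]) => [a1 b1] [a2 b2] /=.
by rewrite !mul0r !mul1r !sub0r => /oppr_inj.
Qed.

Lemma adjoint_exists T :
  exists S : boundedOp H, forall x y, '[T x, y] = '[x, S y].
Proof.
have /choice[S SP] := adjoint_point T.
have [K K0 TK] := opK T.
have innerP u v : (forall x, '[x, u] = '[x, v]) -> u = v.
  move=> uv; apply/eqP; rewrite -subr_eq0 -(dnorm_eq0 (@inner R H)).
  by rewrite linearBr /= uv subrr.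
suff Sb : S \in @bounded_linear R H by exists (BoundedOp Sb) => x y; exact: SP.
apply/asboolP; split=> [c x y|].
  apply: innerP => u; rewrite linearDr /= linearZr_LR /= -!SP.
  by rewrite linearDr linearZr_LR.
exists (Num.sqrt K)%:C => y.
rewrite -(ler_pXn2r (n := 2)) ?nnegrE ?mulr_ge0 ?normr_ge0 ?lecR ?sqrtr_ge0//.
rewrite exprMn -rmorphXn sqr_sqrtr ?(ltW K0)// !normE -rmorphM lecR.
have SS : rip (S y) (S y) = rip (T (S y)) y by rewrite /rip SP.
have := amgm (T (S y)) y (s := K^-1); rewrite invr_gt0 invrK => /(_ K0).
have : K^-1 * rip (T (S y)) (T (S y)) <= rip (S y) (S y).
  by rewrite mulrC ler_pdivrMr// mulrC.
rewrite -SS mulrC (mulrC _ K); lra.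
Qed.

Definition adjoint T : boundedOp H := projT1 (cid (adjoint_exists T)).

Lemma adjointP T x y : '[T x, y] = '[x, adjoint T y].
Proof. exact: (projT2 (cid (adjoint_exists T))). Qed.

End Adjoint.

Section Drazin.
Variable A : pzRingType.
Implicit Types t a b x y : A.

Definition commutator x y := x * y - y * x.

Definition drazin_inverse t td :=
  [/\ commutator td t = 0,
      td ^+ 2 * t = td
    & exists2 p : nat, (1 <= p)%N & t ^+ p.+1 * td = t ^+ p].

Lemma drazin_inverse_unique t a b :
  drazin_inverse t a -> drazin_inverse t b -> a = b.
Proof.
move=> [/subr0_eq at_ta a2t [p _ tpa]] [/subr0_eq bt_tb b2t [q _ tqb]].
pose n := maxn p q.
have ta : t ^+ n.+1 * a = t ^+ n.
  by rewrite -(subnK (leq_maxl p q : p <= n)%N) -addnS !exprD -mulrA tpa.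
have tb : t ^+ n.+1 * b = t ^+ n.
  by rewrite -(subnK (leq_maxr p q : q <= n)%N) -addnS !exprD -mulrA tqb.
have idem c k : c ^+ 2 * t = c -> c ^+ k.+1 * t ^+ k = c.
  move=> c2t; elim: k => [|k IHk]; first by rewrite expr1 expr0 mulr1.
  by rewrite exprS (exprSr t) -mulrA (mulrA (c ^+ k.+1)) IHk mulrA -expr2.
have aE := idem _ n a2t; have bE := idem _ n b2t.
have at1 : a ^+ n.+1 * t ^+ n.+1 = a * t.
  by rewrite (exprSr t) mulrA aE.
have bt1 : t ^+ n.+1 * b ^+ n.+1 = t * b.
  have c : GRing.comm (b ^+ n.+1) (t ^+ n.+1).
    by apply: commrX; apply/commr_sym/commrX/commr_sym.
  by rewrite -c (exprSr t) mulrA bE bt_tb.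
have -> : a = a * t * b by rewrite -at1 -mulrA tb aE.
have c : GRing.comm (t ^+ n.+1) a.
  by apply/commr_sym/commrX.
have cb : GRing.comm (b ^+ n.+1) (t ^+ n).
  by apply: commrX; apply/commr_sym/commrX/commr_sym.
by rewrite -mulrA -bt1 mulrA -c ta -cb bE.
Qed.

End Drazin.

(* Main.v *)
(* [Td] commutes with everything commuting with [T], so the hypothesis and its
   adjoint make [Td] normal, and the claim is Fuglede's theorem for [Td].

   Fuglede's theorem: let [N] be normal, [X] commute with [N], and [S] be the
   adjoint of [N]. A polynomial in [S] has at each vector the same norm as the
   corresponding polynomial in [N], hence
   [|(1 + u S)^n X y| <= |X| |(1 + u S)^n y|]. Put [y = (1 - u S)^n x]: then
   [(1 + u S)^n X (1 - u S)^n x] is a polynomial in [u], with linear coefficient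
   [n (S X - X S) x], and for [|u| = r] its norm is at most
   [|X| (1 + r^2 |S|^2)^n |x|]. Cauchy's estimate, obtained for polynomials by
   averaging over roots of unity, and [r] of order [n^(-1/2)] give
   [S X = X S] as [n] grows; this replaces the exponentials and Liouville's
   theorem of Rosenblum's proof. *)
Require Import Defs.
From mathcomp Require Import all_boot all_order all_algebra ring lra.
From mathcomp Require Import complex.
From mathcomp Require Import boolp reals normedtype.

Set Implicit Arguments.
Unset Strict Implicit.
Unset Printing Implicit Defensive.

Import Order.TTheory GRing.Theory Num.Theory.
Local Open Scope ring_scope.

(** * Roots of unity and extraction of coefficients *)

Lemma prim_root_pow2_exists (K : numClosedFieldType) (k : nat) :
  {z : K | (2 ^ k.+1).-primitive_root z}.
Proof.
(* A [2 ^ k]-th root of -1 has order dividing [2 ^ k.+1]; a smaller power of two would divide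
   [2 ^ k] and force -1 = 1. *)
have z2 : ((2 ^ k)%N.-root (-1 : K)) ^+ (2 ^ k) = -1 by rewrite rootCK ?expn_gt0.
set z := _.-root _ in z2; exists z.
have [m zm] : {m : nat | m.-primitive_root z & (m %| 2 ^ k.+1)%N}.
  by apply: prim_order_exists; rewrite ?expn_gt0// expnSr exprM z2 sqrrN expr1n.
case/(dvdn_pfactor _ _ (isT : prime 2))=> j jk mE.
move: jk; rewrite leq_eqVlt => /predU1P[<-|jk]; first by rewrite -mE.
have : (m %| 2 ^ k)%N by rewrite mE dvdn_exp2l.
rewrite (prim_order_dvd zm) z2 => /eqP/esym /eqP.
by rewrite -addr_eq0 -mulr2n pnatr_eq0.
Qed.

(** Discrete Fourier inversion: after exchanging the sums, [c j] is multiplied by a geometric sum in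
    [z ^- i * z ^+ j], which vanishes unless [j = i]. *)
Lemma prim_root_coef (F : fieldType) (V : lmodType F) (M : nat) (z : F)
    (c : 'I_M -> V) (i : 'I_M) : M.-primitive_root z ->
  \sum_(k < M) (z ^+ k) ^- i *: (\sum_(j < M) (z ^+ k) ^+ j *: c j) = c i *+ M.
Proof.
move=> zM; have z0 : z != 0 by rewrite (prim_root_eq0 zM) -lt0n (prim_order_gt0 zM).
under eq_bigr do rewrite scaler_sumr.
rewrite exchange_big (bigD1 i)//= [X in _ + X]big1 ?addr0 => [|j ji].
  under eq_bigr => k _.
    rewrite scalerA mulVf ?scale1r; first by over.
    by rewrite !expf_neq0.
  by rewrite sumr_const card_ord.
pose w := z ^- i * z ^+ j.
have wE (k : 'I_M) : (z ^+ k) ^- i *: ((z ^+ k) ^+ j *: c j) = w ^+ k *: c j.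
  by rewrite scalerA exprMn exprVn !(exprAC _ k).
under eq_bigr do rewrite wE.
rewrite -scaler_suml.
have w1 : w - 1 != 0.
  rewrite subr_eq0 /w mulrC -(inj_eq (mulIf (expf_neq0 i z0))) divfK ?expf_neq0//.
  by rewrite mul1r (eq_prim_root_expr zM) !modn_small.
have : (w - 1) * \sum_(k < M) w ^+ k = 0.
  rewrite -subrX1 /w exprMn exprVn 2!(exprAC _ _ M) (prim_expr_order zM).
  by rewrite !expr1n invr1 mulr1 subrr.
by move/eqP; rewrite mulf_eq0 (negPf w1) => /eqP ->; rewrite scale0r.
Qed.

(** * Polynomials with vector coefficients and Cauchy's estimate *)

Section VectorPolynomials.
Variables (K : numClosedFieldType).

(* [f] is a polynomial with constant coefficient [a] and linear coefficient [b];
   quantifying over all large [D] allows padding with zero coefficients. *)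
Definition polynomial_with (V : lmodType K) (f : K -> V) (a b : V) :=
  exists c : nat -> V, [/\ c 0 = a, c 1 = b &
    exists d, forall D, (d <= D)%N -> forall u, f u = \sum_(j < D) u ^+ j *: c j].

Lemma polynomial_with_cst (V : lmodType K) (v : V) :
  polynomial_with (fun=> v) v 0.
Proof.
exists (fun j => if j == 0 then v else 0); split=> //; exists 1 => -[//|D] _ u.
by rewrite big_ord_recl scale1r big1 ?addr0// => j _; rewrite scaler0.
Qed.

Lemma polynomial_with_linear (V W : lmodType K) (A : {linear V -> W}) f a b :
  polynomial_with f a b -> polynomial_with (fun u => A (f u)) (A a) (A b).
Proof.
move=> [c [<- <- [d fE]]]; exists (fun j => A (c j)); split=> //.
exists d => D dD u; rewrite (fE _ dD) linear_sum.
by apply: eq_bigr => j _; rewrite linearZ.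
Qed.

Lemma polynomial_with_affine (V : lmodType K) (A : {linear V -> V}) f a b :
  polynomial_with f a b ->
  polynomial_with (fun u => f u + u *: A (f u)) a (b + A a).
Proof.
move=> [c [<- <- [d fE]]].
exists (fun j => if j is j'.+1 then c j + A (c j') else c j); split=> //.
exists d.+1 => -[//|D] dD u; rewrite {1}(fE D.+1 (leqW dD)) (fE _ dD).
rewrite !big_ord_recl -addrA; congr (_ + _).
rewrite linear_sum scaler_sumr -big_split; apply: eq_bigr => j _ /=.
by rewrite linearZ scalerA -exprS scalerDr.
Qed.

(** Cauchy's estimate: averaging [z ^- k *: f (r * z ^+ k)] over the powers of a primitive root of
    unity isolates [r *: b]. *)
Lemma polynomial_with_norm_le (V : normedModType K) (f : K -> V) a b (r B : K) :
  polynomial_with f a b -> 0 < r -> (forall u, `|u| = r -> `|f u| <= B) ->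
  r * `|b| <= B.
Proof.
move=> [c [_ <- [d fE]]] r0 fB.
(* The order [M] must exceed 1, for the index 1 to exist, and be at least [d], for [f] to be a sum
   of [M] terms. *)
have [z zM] := prim_root_pow2_exists K d; set M := (2 ^ d.+1)%N in zM.
have M1 : (1 < M)%N by rewrite /M -{1}(expn0 2) ltn_exp2l.
have dM : (d <= M)%N by rewrite (leq_trans (leqnSn d))// ltnW// ltn_expl.
have z1 : `|z| = 1.
  apply/eqP; rewrite -(@pexpr_eq1 _ _ M) ?normr_ge0 ?(ltnW M1)//.
  by rewrite -normrX (prim_expr_order zM) normr1.
have := prim_root_coef (fun j : 'I_M => r ^+ j *: c j) (Ordinal M1) zM.
move=> /(congr1 Num.norm); rewrite normrMn normrZ /= expr1 (gtr0_norm r0) => cE.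
rewrite -(ler_pMn2r (ltnW M1)) -cE (le_trans (ler_norm_sum _ _ _))//.
rewrite -[X in _ *+ X]card_ord -sumr_const; apply: ler_sum => k _.
rewrite normrZ expr1 normfV normrX z1 expr1n invr1 mul1r.
under eq_bigr do rewrite scalerA -exprMn.
by rewrite -(fE _ dM) fB// normrM normrX z1 expr1n mul1r gtr0_norm.
Qed.

End VectorPolynomials.

(** By induction [(1 + t) ^+ k * (1 - k%:R * t) <= 1], and at [k = n] the second factor is at least
    1/2. *)
Lemma expr1D_le2 (K : realFieldType) (t : K) (n : nat) :
  0 <= t -> n%:R * t <= 2^-1 -> (1 + t) ^+ n <= 2.
Proof.
move=> t0 nt.
have main k : (1 + t) ^+ k * (1 - k%:R * t) <= 1.
  elim: k => [|k IHk]; first by rewrite mul0r subr0 mulr1.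
  apply: le_trans IHk; rewrite exprSr -mulrA ler_wpM2l ?exprn_ge0 ?addr_ge0//.
  have k0 : 0 <= k.+1%:R * t ^+ 2 by rewrite mulr_ge0 ?ler0n ?sqr_ge0.
  by move: k0; rewrite -natr1; lra.
have p0 : 0 <= (1 + t) ^+ n by rewrite exprn_ge0// addr_ge0.
have := main n; have : 0 <= (1 + t) ^+ n * (2^-1 - n%:R * t).
  by rewrite mulr_ge0// subr_ge0.
by rewrite !mulrBr; lra.
Qed.

(** * Adjoints, normal operators and Fuglede's theorem *)

Section Operators.
Variables (R : realType) (H : hilbertType R).
Implicit Types (S T : boundedOp H) (x y : H) (u : R[i]).

Lemma complex_le_natr_eq0 (a b : R[i]) :
  0 <= a -> (forall m : nat, m.+1%:R * a <= b) -> a = 0.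
Proof.
case: a => a a'; rewrite lecE /= => /andP[/eqP-> a0] ab.
have {}ab (m : nat) : m.+1%:R * a <= complex.Re b.
  have := ab m; rewrite lecE => /andP[_].
  by rewrite -[m.+1%:R](rmorph_nat (real_complex R)) /= mul0r subr0.
have [->//|aN0] := eqVneq a 0.
have {}a0 : 0 < a by rewrite lt_neqAle eq_sym aN0.
have := ab (Num.truncn (complex.Re b / a)).
by rewrite -ler_pdivlMr// leNgt truncnS_gt.
Qed.

Lemma bop_scale_subproof u T : (fun x => u *: T x) \in @bounded_linear R H.
Proof.
apply/asboolP; split=> [a x y|].
  by rewrite linearP scalerDr !scalerA mulrC.
have [M M0 TM] := bop_bounded T; exists (`|u| * M) => x.
by rewrite normrZ -mulrA ler_wpM2l.
Qed.

Definition bop_scale u T : boundedOp H := BoundedOp (bop_scale_subproof u T).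

Lemma bop_expS T n x : (T ^+ n.+1) x = T ((T ^+ n) x).
Proof. by rewrite exprS. Qed.

Lemma inner_inj x y : (forall z, '[z, x] = '[z, y]) -> x = y.
Proof.
move=> xy; apply/eqP; rewrite -subr_eq0 -(dnorm_eq0 (@inner R H)).
by rewrite linearBr /= xy subrr.
Qed.

Lemma inner_conj x y : '[x, y] = Num.conj '[y, x].
Proof. by rewrite hermC expr0 mul1r. Qed.

Lemma adjoint_unique T S : (forall x y, '[T x, y] = '[x, S y]) -> adjoint T = S.
Proof.
by move=> TS; apply/bopP => y; apply: inner_inj => x; rewrite -adjointP.
Qed.

Lemma adjointK : involutive (@adjoint R H).
Proof.
by move=> T; apply: adjoint_unique => x y; rewrite inner_conj -adjointP -inner_conj.
Qed.

Lemma adjointM S T : adjoint (S * T) = adjoint T * adjoint S.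
Proof. by apply: adjoint_unique => x y; rewrite /= -!adjointP. Qed.

Lemma adjoint1 : adjoint (1 : boundedOp H) = 1.
Proof. exact: adjoint_unique. Qed.

Lemma adjointD S T : adjoint (S + T) = adjoint S + adjoint T.
Proof. by apply: adjoint_unique => x y; rewrite linearDl linearDr /= -!adjointP. Qed.

Lemma adjoint_scale u T : adjoint (bop_scale u T) = bop_scale (Num.conj u) (adjoint T).
Proof.
apply: adjoint_unique => x y.
by rewrite linearZl_LR linearZr_LR /= -adjointP conjCK.
Qed.

Lemma adjointX T n : adjoint (T ^+ n) = adjoint T ^+ n.
Proof.
elim: n => [|n IHn]; first exact: adjoint1.
by rewrite exprS adjointM IHn exprSr.
Qed.

Lemma adjoint_comm S T : GRing.comm S T -> GRing.comm (adjoint S) (adjoint T).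
Proof. by rewrite /GRing.comm -!adjointM => ->. Qed.

Lemma norm_adjoint_normal T x :
  GRing.comm T (adjoint T) -> `|adjoint T x| = `|T x|.
Proof.
move=> TT; apply/eqP; rewrite -(eqrXn2 (n := 2)) ?normr_ge0//.
rewrite !sqr_normE adjointP (adjointP T) adjointK.
by have /bopP/(_ x) := TT; move=> /= ->.
Qed.

Lemma bop_scale_comm u S T : GRing.comm S T -> GRing.comm S (bop_scale u T).
Proof.
by move=> /bopP ST; apply/bopP => x /=; rewrite linearZ; congr (_ *: _); exact: ST.
Qed.

(** Each of the [n] affine factors adds [e *: S a] to the linear coefficient. The sign [e] lets the
    result serve both [1 + u S] and [1 - u S]. *)
Lemma polynomial_with_exp1D (S : boundedOp H) (e : R[i]) f a b n :
  polynomial_with f a b ->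
  polynomial_with
    (fun u => ((1 + bop_scale (e * u) S) ^+ n) (f u)) a (b + (e *: S a) *+ n).
Proof.
move=> fab; elim: n => [|n IHn]; first by rewrite addr0.
have := polynomial_with_affine (bop_scale e S) IHn.
rewrite -addrA -mulrSr; set g := (X in polynomial_with X) => gP.
set h := (X in polynomial_with X); suff -> : h = g by [].
apply/funext => u; rewrite /h /g bop_expS /=.
by rewrite scalerA mulrC.
Qed.

(** The operator is the adjoint of the normal [Q ^+ n], so [Q ^+ n] replaces it inside norms; this
    power commutes with [X]. *)
Lemma norm_exp1D_adjoint_le (N X : boundedOp H) (C u : R[i]) n y :
  GRing.comm N (adjoint N) -> GRing.comm X N ->
  (forall x, `|X x| <= C * `|x|) ->
  `|((1 + bop_scale u (adjoint N)) ^+ n) (X y)|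
    <= C * `|((1 + bop_scale u (adjoint N)) ^+ n) y|.
Proof.
move=> NN XN XC; pose Q := 1 + bop_scale (Num.conj u) N.
have QE : 1 + bop_scale u (adjoint N) = adjoint Q.
  by rewrite adjointD adjoint1 adjoint_scale conjCK.
have QQ : GRing.comm (Q ^+ n) (adjoint (Q ^+ n)).
  rewrite adjointX; apply/commrX/commr_sym/commrX.
  rewrite -QE; apply: commrD; first exact: commr1.
  apply: bop_scale_comm; apply/commr_sym; apply: commrD; first exact: commr1.
  by apply: bop_scale_comm; apply/commr_sym.
have XQ : GRing.comm X (Q ^+ n).
  by apply/commrX/commrD; [exact: commr1|exact: bop_scale_comm].
rewrite QE -adjointX !norm_adjoint_normal//.
by have /bopP/(_ y) /= <- := XQ.
Qed.

(** The two factors commute and their product is a power of [1 - (u S)^2]: the linear terms cancel,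
    so the bound is quadratic in [u]. *)
Lemma norm_exp1B_le (S : boundedOp H) (s u : R[i]) n x :
  0 <= s -> (forall x, `|S x| <= s * `|x|) ->
  `|((1 + bop_scale u S) ^+ n) (((1 + bop_scale (-1 * u) S) ^+ n) x)|
    <= (1 + (`|u| * s) ^+ 2) ^+ n * `|x|.
Proof.
move=> s0 Ss; set A := 1 + _; set B := 1 + _.
have AB : A * B = 1 - bop_scale u S * bop_scale u S.
  apply/bopP => y.
  change (y + (-1 * u) *: S y + u *: S (y + (-1 * u) *: S y)
    = y - u *: S (u *: S y)).
  by rewrite mulN1r !scaleNr [S (_ - _)]linearB scalerBr addrA subrK.
have ABC : GRing.comm A B.
  have c : GRing.comm S S by [].
  apply: commrD; first exact: commr1.
  apply: bop_scale_comm; apply/commr_sym; apply: commrD; first exact: commr1.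
  exact: bop_scale_comm.
have -> : (A ^+ n) ((B ^+ n) x) = ((A * B) ^+ n) x by rewrite exprMn_comm.
have us0 : 0 <= 1 + (`|u| * s) ^+ 2 by rewrite addr_ge0// exprn_ge0// mulr_ge0.
have uS y : `|bop_scale u S y| <= `|u| * s * `|y|.
  by rewrite /= normrZ -mulrA ler_wpM2l.
rewrite {}AB; elim: n => [|n IHn]; first by rewrite mul1r.
rewrite bop_expS; set y := _ x in IHn *.
rewrite exprS -mulrA; apply: le_trans (ler_wpM2l us0 IHn).
rewrite mulrDl mul1r (le_trans (ler_normB _ _))// lerD2l.
rewrite (le_trans (uS _))// expr2 -(mulrA (`|u| * s) (`|u| * s)).
by apply: ler_wpM2l; [exact: mulr_ge0|exact: uS].
Qed.

Theorem fuglede (N X : boundedOp H) :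
  GRing.comm N (adjoint N) -> GRing.comm X N -> GRing.comm X (adjoint N).
Proof.
move=> NN XN; have [C C0 XC] := bop_bounded X.
set S := adjoint N.
(* The bound is made strictly positive because [r] below divides by it. *)
have [s s_gt0 Ss] :
    exists2 s : R[i], 0 < s & forall x, `|S x| <= s * `|x|.
  have [s s0 Ss] := bop_bounded S; exists (s + 1) => [|x].
    by rewrite ltr_wpDl.
  by rewrite (le_trans (Ss x))// ler_wpM2r// lerDl.
have s0 := ltW s_gt0.
apply/bopP => x; apply/esym/eqP; rewrite -subr_eq0 -normr_eq0; apply/eqP.
apply: (complex_le_natr_eq0 (b := C * 2 * `|x| * s)) => // m; set D := _ - _.
(* These give [n (r s)^2 = 1/2], which keeps the growth factor below 2, while [n r s = m + 1] is
   unbounded. *)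
pose n := (2 * m.+1 ^ 2)%N; pose r : R[i] := ((2 * m.+1)%:R * s)^-1.
have r0 : 0 < r by rewrite invr_gt0 mulr_gt0 ?ltr0n.
have fP : polynomial_with
    (fun u => ((1 + bop_scale (1 * u) S) ^+ n)
                (X (((1 + bop_scale (-1 * u) S) ^+ n) x))) (X x) (D *+ n).
  (* The inner power contributes [- X (S x)] and the outer one [S (X x)], each [n] times. *)
  have p := polynomial_with_exp1D S (-1) n (polynomial_with_cst x).
  have := polynomial_with_exp1D S 1 n (polynomial_with_linear X p).
  rewrite add0r scaleN1r scale1r linearMn linearN -mulrnDl.
  by rewrite [- _ + _]addrC.
have rs : (r * s) ^+ 2 = ((2 * m.+1)%:R ^- 2).
  by rewrite /r invfM -mulrA mulVf ?gt_eqF// mulr1 exprVn.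
have rs2 : (1 + (r * s) ^+ 2) ^+ n <= 2.
  rewrite rs -natrX -(rmorph_nat (real_complex R)) -fmorphV.
  rewrite -(rmorph1 (real_complex R)) -rmorphD -rmorphXn.
  rewrite -(rmorph_nat (real_complex R) 2) lecR.
  apply: expr1D_le2; first by rewrite invr_ge0 ler0n.
  rewrite /n natrM !natrX natrM le_eqVlt; apply/orP; left; apply/eqP.
  have m0 : m.+1%:R != 0 :> R by rewrite pnatr_eq0.
  by move: (m.+1%:R) m0 => a a0; field.
have := polynomial_with_norm_le (B := C * (2 * `|x|)) fP r0.
move=> /(_ _)/wrap[u ur|].
  rewrite mul1r (le_trans (norm_exp1D_adjoint_le _ _ _ NN XN XC))// ler_wpM2l//.
  by rewrite (le_trans (norm_exp1B_le _ _ _ s0 Ss))// ur ler_wpM2r//.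
rewrite normrMn -(ler_pM2r s_gt0) => h; apply: le_trans (le_trans _ h) _.
  rewrite -[_ *+ n]mulr_natr /r /n !natrM.
  rewrite le_eqVlt; apply/orP; left; apply/eqP.
  have m0 : m.+1%:R != 0 :> R[i] by rewrite pnatr_eq0.
  have s_neq0 : s != 0 by rewrite gt_eqF.
  by move: (m.+1%:R) m0 => a a0; field; rewrite s_neq0 a0.
by rewrite !mulrA.
Qed.

End Operators.

(** * The Drazin inverse lies in the double commutant *)

Lemma drazin_inverse_comm (A : pzRingType) (t td x : A) :
  drazin_inverse t td -> GRing.comm t x -> GRing.comm td x.
Proof.
move=> [/subr0_eq tdt td2t [p p_gt0 tp]] tx.
have txp : t ^+ p * x = x * t ^+ p by apply/commr_sym/commrX/commr_sym.
(* Once the idempotent [e] commutes with [x], [td x = td x e = td x t td = e x td = x e td = x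
   td]. *)
pose e := td * t.
have tde : td = td * e by rewrite /e mulrA -expr2 td2t.
have etd : td = e * td by rewrite /e -mulrA -tdt mulrA -expr2 td2t.
have tpe : t ^+ p * e = t ^+ p by rewrite /e tdt mulrA -exprSr tp.
have ep : e ^+ p = e.
  case: p p_gt0 {tp txp tpe} => // p _; elim: p => [//|p IHp].
  by rewrite exprS IHp /e mulrA -etd.
have e_l : td ^+ p * t ^+ p = e by rewrite -exprMn_comm.
have e_r : t ^+ p * td ^+ p = e by rewrite -exprMn_comm -?tdt.
have ept : e * t ^+ p = t ^+ p by rewrite -{1}e_r -mulrA e_l.
(* Write [e] as [td ^+ p * t ^+ p] on the left of [x], or as [t ^+ p * td ^+ p] on its right;
   [t ^+ p] passes through [x] and absorbs [e]. *)
have exe : e * x = e * x * e.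
  by rewrite -[in LHS]e_l -mulrA txp -tpe [x * _]mulrA -txp !mulrA e_l.
have xee : x * e = e * x * e.
  by rewrite -[in LHS]e_r mulrA -txp -{1}ept -(mulrA e) txp mulrA -mulrA e_r.
have ex : e * x = x * e by rewrite exe -xee.
by rewrite /GRing.comm {1}tde -mulrA ex {1}/e tdt !mulrA -(mulrA td) -tx mulrA
  -/e ex -mulrA -etd.
Qed.

Theorem mainTheorem5 (R : realType) (H : hilbertType R)
    (H_inf : infinite_dimensional H)
    (T Td : boundedOp H)
    (Td_drazin : drazin_inverse T Td)
    (T_DN : commutator Td (adjoint T) = 0)
    (X : boundedOp H)
    (TX : commutator T X = 0) :
  commutator (adjoint Td) X = 0.
Proof.
(* Taking adjoints, [T] commutes with [adjoint Td]. *)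
move/subr0_eq: T_DN => /adjoint_comm; rewrite adjointK => /commr_sym TTd.
have TdTd : GRing.comm Td (adjoint Td) := drazin_inverse_comm Td_drazin TTd.
have TdX : GRing.comm Td X := drazin_inverse_comm Td_drazin (subr0_eq TX).
have := fuglede TdTd (commr_sym TdX).
by rewrite /commutator => ->; rewrite subrr.
Qed.
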